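(* Let $G$ be a simple bipartite graph with no isolated vertices whose vertices are partitioned as $A\cup B$ (every edge joining a vertex of $A$ to a vertex of $B$) with $|A|=a$ and $|B|=b$. Let $s,s',t,t'$ be positive integers with $as+bt=as'+bt'$. Let $H$ be the simple graph obtained from $G$ by replacing each vertex in $A$ with $s$ independent vertices, each vertex in $B$ with $t$ independent vertices, and each edge of $G$ with a copy of the complete bipartite graph $K_{s,t}$ connecting the corresponding sets of vertices. Let $H'$ be obtained from $G$ in the same way using $s'$ and $t'$ in place of $s$ and $t$. Then $H$ and $H'$ are cospectral with respect to the normalized Laplacian, i.e. their normalized Laplacian matrices have the same eigenvalues counting multiplicity. Moreover, if $st\neq s't'$, then $H$ and $H'$ have different numbers of edges.
   Context: Graphs are finite and have at least one vertex. For a simple graph with no vertices of degree $0$, adjacency matrix $A$ and diagonal degree matrix $D$, the normalized Laplacian is $\mathcal{L}=D^{-1/2}(D-A)D^{-1/2}$. *)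

(* Defs.v *)
From HB Require Import structures.
From mathcomp Require Import all_boot all_order all_algebra.

Set Implicit Arguments.
Unset Strict Implicit.
Unset Printing Implicit Defensive.

Import GRing.Theory Num.Theory.
Local Open Scope ring_scope.

Record sgraph := SGraph {
  vertex :> finType;
  adj : rel vertex;
  adj_sym : symmetric adj;
  adj_irrefl : irreflexive adj }.

Definition no_isolated (G : sgraph) : Prop :=
  forall x : G, exists y : G, adj x y.

Definition bipartition (G : sgraph) (A B : {set G}) : Prop :=
  [/\ A :|: B = [set: G], [disjoint A & B] &
      forall x y : G, adj x y ->
        (x \in A /\ y \in B) \/ (x \in B /\ y \in A)].

Definition deg (G : sgraph) (x : G) : nat := #|[set y : G | adj x y]|.

Definition edges (G : sgraph) : {set {set G}} :=
  [set [set p.1; p.2] | p : G * G & adj p.1 p.2].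

(* Matrices of a graph are indexed by 'I_#|G| through the enumeration of the
   vertices; the choice of enumeration only affects them up to conjugation by
   a permutation matrix. *)
Definition adj_mx (R : rcfType) (G : sgraph) : 'M[R]_#|G| :=
  \matrix_(i, j) (adj (enum_val i) (enum_val j))%:R.

Definition deg_mx (R : rcfType) (G : sgraph) : 'M[R]_#|G| :=
  diag_mx (\row_i (deg (enum_val i))%:R).

Definition deg_mx_invsqrt (R : rcfType) (G : sgraph) : 'M[R]_#|G| :=
  diag_mx (\row_i (Num.sqrt (deg (enum_val i))%:R)^-1).

Definition norm_laplacian (R : rcfType) (G : sgraph) : 'M[R]_#|G| :=
  deg_mx_invsqrt R G *m (deg_mx R G - adj_mx R G) *m deg_mx_invsqrt R G.

(* mup x p is the multiplicity of x as a root of p, which is 0 when x is not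
   a root, so this compares algebraic multiplicities of eigenvalues. The
   normalized Laplacian is symmetric, so all its eigenvalues lie in the real
   closed field R and letting x range over R covers the whole spectrum. *)
Definition norm_laplacian_cospectral (R : rcfType) (G1 G2 : sgraph) : Prop :=
  forall x : R, mup x (char_poly (norm_laplacian R G1))
              = mup x (char_poly (norm_laplacian R G2)).

Section Blowup.
Variables (G : sgraph) (A : {set G}) (s t : nat).

(* The copies of a vertex v are the pairs (v, i) with i < s if v is in A, and
   i < t otherwise. *)
Definition blowup_vertex : finType :=
  {v : G & 'I_(if v \in A then s else t)}.

(* Copies of adjacent vertices are all joined, and copies of the same vertex
   are independent since adj is irreflexive. When A is one side of a
   bipartition of G, each edge thus becomes a complete bipartite K_{s,t}. *)
Definition blowup_adj : rel blowup_vertex :=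
  [rel x y | adj (tag x) (tag y)].

Lemma blowup_adj_sym : symmetric blowup_adj.
Proof. by move=> x y; apply: adj_sym. Qed.

Lemma blowup_adj_irrefl : irreflexive blowup_adj.
Proof. by move=> x; apply: adj_irrefl. Qed.

Definition blowup : sgraph := SGraph blowup_adj_sym blowup_adj_irrefl.

End Blowup.

(* Main.v *)
Require Import Defs.
From mathcomp Require Import all_boot all_order all_algebra.

Set Implicit Arguments.
Unset Strict Implicit.
Unset Printing Implicit Defensive.

Import Order.TTheory GRing.Theory Num.Theory.

(** Write [H] for the blow-up of [G] with fibre sizes [s] over [A] and [t] over
    [B], and [N(K) = D^-1/2 A(K) D^-1/2] for the normalized adjacency matrix of
    a graph [K], so that its normalized Laplacian is [1 - N(K)].

    A vertex of [H] over [A] has [t] times the degree of its image in [G], one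
    over [B] has [s] times that degree.  The factor [sqrt (s * t)] this puts in
    the denominator of each entry of [N(H)] is exactly what normalizing the
    indicator vectors of the fibres produces: if [Q] is the matrix whose columns
    are the unit vectors supported uniformly on the fibres, then
    [N(H) = Q N(G) Q^T] with [Q^T Q = 1] ([norm_adj_blowup],
    [fibre_mx_isometry]).  Hence [N(H)] is [N(G)] on the range of [Q] and
    vanishes on the orthogonal complement: the spectrum of the normalized
    Laplacian of [H] is that of [G] together with [|H| - |G|] extra eigenvalues
    1.  It depends on [s] and [t] only through [|H| = |A| s + |B| t].  The
    multiplicities come from the determinant identity
    [det (c + U V) c^m = c^n det (c + V U)] ([det_scalar_add_mulmx]), which
    yields the formula of [char_poly_norm_laplacian_blowup].

    For the edges, [H] has [s * t] times as many as [G] ([card_edges_blowup]),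
    and [G] has at least one edge. *)

(** * Characteristic polynomials of compressed matrices *)

Section Determinants.
Local Open Scope ring_scope.

(** Eliminating the lower left or the upper right block of
    [block_mx c (- U) V 1] computes its determinant in two ways.  The factor
    [c ^+ m] avoids dividing by [c], so that [c] may be a polynomial. *)
Lemma det_scalar_add_mulmx (R : comNzRingType) (m n : nat) (c : R)
    (U : 'M[R]_(n, m)) (V : 'M[R]_(m, n)) :
  \det (c%:M + U *m V) * c ^+ m = c ^+ n * \det (c%:M + V *m U).
Proof.
pose M := block_mx c%:M (- U) V (1%:M : 'M[R]_m).
have detMl : \det M = \det (c%:M + U *m V).
  have -> : \det M = \det (M *m block_mx 1%:M 0 (- V) 1%:M).
    by rewrite det_mulmx det_lblock !det1 !mulr1.
  rewrite mulmx_block !mulmx1 !mulmx0 !mul1mx !add0r mulmxN mulNmx opprK.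
  by rewrite addrN det_ublock det1 mulr1.
have detMr : \det M * c ^+ m = c ^+ n * \det (c%:M + V *m U).
  have -> : \det M * c ^+ m = \det (M *m block_mx 1%:M U 0 c%:M).
    by rewrite det_mulmx det_ublock det1 mul1r det_scalar.
  rewrite mulmx_block !mulmx1 !mulmx0 !mul1mx !addr0 mulNmx -scalar_mxC subrr.
  by rewrite det_lblock det_scalar [V *m U + _]addrC.
by rewrite -detMl.
Qed.

(** In [det ('X - 1 + (Q N) Q^T)] the two factors can be exchanged at the cost
    of powers of ['X - 1], and then [Q^T Q] cancels. *)
Lemma char_poly_compression (F : fieldType) (m n : nat)
    (Q : 'M[F]_(n, m)) (N : 'M[F]_m) :
  Q^T *m Q = 1%:M ->
  char_poly (1%:M - Q *m N *m Q^T) * ('X - 1) ^+ m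
    = ('X - 1) ^+ n * \det (('X - 1)%:M + map_mx polyC N).
Proof.
move=> QtQ; rewrite /char_poly.
have -> : char_poly_mx (1%:M - Q *m N *m Q^T)
    = ('X - 1)%:M + map_mx polyC (Q *m N) *m map_mx polyC Q^T.
  rewrite /char_poly_mx map_mxB map_scalar_mx /= -map_mxM opprB addrCA addrC.
  by rewrite raddfB.
rewrite det_scalar_add_mulmx; congr (_ * \det (_ + _)).
by rewrite -map_mxM mulmxA QtQ mul1mx.
Qed.

End Determinants.

(** * Bipartite graphs *)

Section Bipartition.
Variables (G : sgraph) (A B : {set G}).
Hypothesis hAB : bipartition A B.

Lemma bipartition_notin (x : G) : (x \in B) = (x \notin A).
Proof.
case: hAB => cAB dAB _.
apply/idP/idP => [xB | xA]; first by rewrite (disjointFl dAB xB).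
have: x \in A :|: B by rewrite cAB inE.
by rewrite inE (negPf xA).
Qed.

Lemma bipartition_adj (x y : G) : adj x y -> (y \in A) = (x \notin A).
Proof.
case: hAB => _ _ hadj /hadj[] [hx hy]; move: hx hy; rewrite bipartition_notin.
  by move=> -> /negPf.
by move=> -> ->.
Qed.

(** Each edge is listed once when it is oriented from [A] to [B]. *)
Lemma card_edges_bipartite : #|edges G| = \sum_(x in A) deg x.
Proof.
have adjNA (x y : G) : adj x y -> x \in A -> y \notin A.
  by move=> xy xA; rewrite (bipartition_adj xy) negbK.
pose arcs := [set p : G * G | (p.1 \in A) && adj p.1 p.2].
have -> : edges G = [set [set p.1; p.2] | p in arcs].
  apply/setP => e; apply/imsetP/imsetP => [] [[x y]] /=; rewrite !inE /=.
    move=> xy ->; have [xA | xNA] := boolP (x \in A).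
      by exists (x, y); rewrite ?inE /= ?xA.
    exists (y, x); last by rewrite setUC.
    by rewrite inE /= (bipartition_adj xy) xNA adj_sym.
  by case/andP=> xA xy ->; exists (x, y); rewrite ?inE.
rewrite card_in_imset; last first.
  move=> [x y] [x' y']; rewrite !inE /= => /andP[xA xy] /andP[x'A x'y'] exy.
  have : x \in [set x'; y'] by rewrite -exy set21.
  have : y \in [set x'; y'] by rewrite -exy set22.
  have yA := adjNA _ _ xy xA; have y'A := adjNA _ _ x'y' x'A.
  rewrite !inE => /orP[/eqP ey|/eqP ->]; first by rewrite ey x'A in yA.
  by case/orP=> /eqP ex; [rewrite ex | rewrite -ex xA in y'A].
rewrite -sum1_card (eq_bigl (fun p => (p.1 \in A) && adj p.1 p.2)); last first.
  by move=> p; rewrite inE.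
rewrite -(pair_big_dep (mem A) (fun x y => adj x y) (fun _ _ => 1)) /=.
by apply: eq_bigr => x _; rewrite /deg -sum1_card; apply: eq_bigl => y; rewrite inE.
Qed.

End Bipartition.

(** * Vertices, degrees and edges of a blow-up *)

Section BlowupCounting.
Variables (G : sgraph) (A : {set G}) (s t : nat).

Notation H := (blowup A s t).
Let w (v : G) : nat := if v \in A then s else t.

(** A function that is constant on fibres is summed with the fibre sizes as
    weights; vertices, degrees and matrix products in [H] all reduce to this. *)
Lemma sum_blowup (S : nmodType) (P : pred G) (F : G -> S) :
  (\sum_(x : H | P (tag x)) F (tag x) = \sum_(v | P v) F v *+ w v)%R.
Proof.
rewrite (eq_bigl (fun x : H => P (tag x) && true)); last by move=> x; rewrite andbT.
rewrite -(@sig_big_dep _ _ _ G (fun v => 'I_(w v)) P (fun _ => xpredT) (fun v _ => F v)).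
by apply: eq_bigr => v _; rewrite sumr_const card_ord.
Qed.

Lemma sum_blowup_nat (P : pred G) (F : G -> nat) :
  \sum_(x : H | P (tag x)) F (tag x) = \sum_(v | P v) F v * w v.
Proof.
rewrite (sum_blowup P F); apply: eq_bigr => v _.
by rewrite -GRing.mulr_natr natn.
Qed.

Variable B : {set G}.
Hypothesis hAB : bipartition A B.

Lemma blowup_bipartition :
  @bipartition H [set x | tag x \in A] [set x | tag x \in B].
Proof.
split.
- by apply/setP => x; rewrite !inE (bipartition_notin hAB) orbN.
- by rewrite -setI_eq0; apply/eqP/setP => x; rewrite !inE (bipartition_notin hAB) andbN.
- by move=> x y xy; rewrite !inE; case: hAB => _ _; apply.
Qed.

Lemma card_blowup : #|H| = #|A| * s + #|B| * t.
Proof.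
have -> : #|H| = \sum_(x : H | predT (tag x)) 1.
  by rewrite -sum1_card; apply: eq_bigl => x.
rewrite (sum_blowup_nat predT (fun _ => 1)) (bigID (mem A)) /=.
rewrite -!sum_nat_const; congr (_ + _).
  by apply: eq_bigr => v vA; rewrite /w vA mul1n.
apply: eq_big => [v | v /negPf vA]; first by rewrite (bipartition_notin hAB).
by rewrite /w vA mul1n.
Qed.

Lemma deg_blowup (x : H) :
  deg x = deg (tag x) * (if tag x \in A then t else s).
Proof.
rewrite {1}/deg -sum1dep_card (sum_blowup_nat (fun v => adj (tag x) v) (fun _ => 1)).
rewrite /deg -sum1dep_card big_distrl /=; apply: eq_bigr => v xv.
by rewrite /w (bipartition_adj hAB xv) if_neg.
Qed.

(** Sum over the side [A]: a vertex [v] has [s] copies, each of degree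
    [t * deg v]. *)
Lemma card_edges_blowup : #|edges H| = s * t * #|edges G|.
Proof.
rewrite (card_edges_bipartite blowup_bipartition) (card_edges_bipartite hAB).
rewrite (eq_bigl (fun x : H => tag x \in A)); last by move=> x; rewrite inE.
rewrite (eq_bigr (fun x : H => deg (tag x) * t)); last first.
  by move=> x xA; rewrite deg_blowup xA.
rewrite (sum_blowup_nat (mem A) (fun v => deg v * t)) big_distrr /=.
by apply: eq_bigr => v vA; rewrite /w vA -mulnA mulnC [t * s]mulnC.
Qed.

End BlowupCounting.

(** * The normalized Laplacian of a blow-up *)

Section Spectrum.
Local Open Scope ring_scope.
Variable R : rcfType.

Lemma no_isolated_deg_gt0 (G : sgraph) (x : G) : no_isolated G -> (0 < deg x)%N.
Proof. by case/(_ x) => y xy; apply/card_gt0P; exists y; rewrite inE. Qed.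

(** [D^-1/2 A D^-1/2]. *)
Definition norm_adj (G : sgraph) : 'M[R]_#|G| :=
  \matrix_(i, j) ((adj (enum_val i) (enum_val j))%:R
    / Num.sqrt (deg (enum_val i) * deg (enum_val j))%:R).

Lemma norm_laplacianE (G : sgraph) :
  no_isolated G -> norm_laplacian R G = 1%:M - norm_adj G.
Proof.
move=> hiso; apply/matrixP => i j.
rewrite /norm_laplacian /deg_mx_invsqrt mul_mx_diag mul_diag_mx !mxE.
have dgt0 (k : 'I_#|G|) : 0 < (deg (enum_val k))%:R :> R.
  by rewrite ltr0n no_isolated_deg_gt0.
rewrite natrM sqrtrM ?ltW // invfM mulrBr mulrBl; congr (_ - _); last first.
  by rewrite mulrCA mulrA.
have [<-|_] := eqVneq i j; last by rewrite mulr0n mulr0 mul0r.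
rewrite !mulr1n mulrAC -invfM -expr2 sqr_sqrtr ?ltW // mulVf //.
by rewrite gt_eqF.
Qed.

Variables (G : sgraph) (A B : {set G}) (s t : nat).
Hypotheses (hAB : bipartition A B) (hs : (0 < s)%N) (ht : (0 < t)%N).
Hypothesis hiso : no_isolated G.

Notation H := (blowup A s t).
Let w (v : G) : nat := if v \in A then s else t.

Let w_gt0 v : 0 < (w v)%:R :> R.
Proof. by rewrite ltr0n /w; case: ifP. Qed.

Lemma no_isolated_blowup : no_isolated H.
Proof.
move=> x; case: (hiso (tag x)) => y xy.
have wy : (0 < if y \in A then s else t)%N by case: ifP.
by exists (Tagged (fun v => 'I_(if v \in A then s else t)) (Ordinal wy)).
Qed.

(** The column of [k] is the indicator vector of the fibre over [k], divided by
    its Euclidean length. *)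
Definition fibre_mx : 'M[R]_(#|H|, #|G|) :=
  \matrix_(i, k) ((tag (enum_val i) == enum_val k)%:R
    / Num.sqrt (w (enum_val k))%:R).

(** Distinct fibres are disjoint, so their indicator vectors are orthogonal. *)
Lemma fibre_mx_isometry : fibre_mx^T *m fibre_mx = 1%:M.
Proof.
apply/matrixP => k l; rewrite !mxE.
pose F (v : G) := (v == enum_val k)%:R / Num.sqrt (w (enum_val k))%:R
  * ((v == enum_val l)%:R / Num.sqrt (w (enum_val l))%:R) : R.
rewrite (eq_bigr (fun i => F (tag (enum_val i : H)))); last by move=> i _; rewrite !mxE.
rewrite -(@big_enum_val _ _ _ _ H (fun x : H => F (tag x))) /=.
rewrite (sum_blowup A s t predT F) (bigD1 (enum_val k)) //= big1 ?addr0.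
  rewrite /F eqxx (inj_eq enum_val_inj) -/(w _).
  have [<-|_] := eqVneq k l; last by rewrite !mul0r mulr0 mul0rn.
  rewrite !mul1r -invfM -expr2 sqr_sqrtr ?ltW // -[LHS]mulr_natl divff //.
  by rewrite gt_eqF.
by move=> v /negPf vk; rewrite /F vk !mul0r mul0rn.
Qed.

(** Over an edge [uv] of [G], one endpoint lies in [A] and the other in [B], so
    the two degrees in [H] contribute an extra factor [s * t] under the square
    root; this is the product of the two fibre sizes, which appears in the same
    place on the right-hand side. *)
Lemma norm_adj_blowup : norm_adj H = fibre_mx *m norm_adj G *m fibre_mx^T.
Proof.
have rowE p (M : 'M[R]_(#|G|, p)) i k : (fibre_mx *m M) i k
    = M (enum_rank (tag (enum_val i))) k / Num.sqrt (w (tag (enum_val i)))%:R.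
  rewrite mxE (bigD1 (enum_rank (tag (enum_val i)))) //= big1 ?addr0.
    by rewrite !mxE enum_rankK eqxx mul1r mulrC.
  move=> j; rewrite -(inj_eq enum_val_inj) enum_rankK eq_sym => /negPf ji.
  by rewrite mxE ji !mul0r.
(* Written so that both outer factors act from the left, where rowE applies. *)
have -> : fibre_mx *m norm_adj G *m fibre_mx^T
   = (fibre_mx *m (fibre_mx *m norm_adj G)^T)^T by rewrite trmx_mul trmxK.
apply/matrixP => i j; rewrite [RHS]mxE rowE [X in _ = X / _]mxE rowE !mxE !enum_rankK.
set u := tag (enum_val i); set v := tag (enum_val j).
have -> : adj (enum_val i) (enum_val j) = adj u v by [].
case uv: (adj u v); last by rewrite !mul0r.
rewrite !mul1r -!invfM -!sqrtrM ?mulr_ge0 ?ler0n // -!natrM.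
rewrite !(deg_blowup hAB) -/u -/v (bipartition_adj hAB uv) if_neg.
rewrite /w (bipartition_adj hAB uv) if_neg.
congr (Num.sqrt _%:R)^-1.
by case: ifP => _; rewrite mulnACA -!mulnA // [(t * s)%N]mulnC.
Qed.

Lemma char_poly_norm_laplacian_blowup :
  char_poly (norm_laplacian R H) * ('X - 1) ^+ #|G|
    = ('X - 1) ^+ (#|A| * s + #|B| * t)
      * \det (('X - 1)%:M + map_mx polyC (norm_adj G)).
Proof.
rewrite norm_laplacianE; last exact: no_isolated_blowup.
rewrite norm_adj_blowup (char_poly_compression _ fibre_mx_isometry).
by rewrite (card_blowup s t hAB).
Qed.

End Spectrum.

Theorem mainTheorem3 (R : rcfType) (G : sgraph) (A B : {set G})
    (a b s s' t t' : nat)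
    (hG : (0 < #|G|)%N)
    (hiso : no_isolated G)
    (hAB : bipartition A B)
    (ha : #|A| = a) (hb : #|B| = b)
    (hs : (0 < s)%N) (hs' : (0 < s')%N) (ht : (0 < t)%N) (ht' : (0 < t')%N)
    (heq : (a * s + b * t = a * s' + b * t')%N) :
  norm_laplacian_cospectral R (blowup A s t) (blowup A s' t') /\
  ((s * t)%N <> (s' * t')%N ->
     #|edges (blowup A s t)| <> #|edges (blowup A s' t')|).
Proof.
split=> [x | st_neq].
  have X1_neq0 : ('X - 1 : {poly R})%R != 0%R by rewrite -polyC1 polyXsubC_eq0.
  (* Both characteristic polynomials become equal after multiplication by the
     nonzero polynomial ('X - 1) ^+ #|G|. *)
  congr mup; apply: (mulIf (expf_neq0 #|G| X1_neq0)).
  rewrite !(char_poly_norm_laplacian_blowup R hAB) //.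
  by rewrite ha hb heq.
rewrite !(card_edges_blowup _ _ hAB) => /eqP; rewrite eqn_pmul2r.
  by move/eqP.
case/card_gt0P: hG => x _; case: (hiso x) => y xy.
by apply/card_gt0P; exists [set x; y]; apply/imsetP; exists (x, y); rewrite ?inE.
Qed.
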